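(* Let $\mathbb K$ be a field of characteristic $0$ and let $\mathcal A\subset\mathbb P^2_{\mathbb K}$ be a line arrangement of rank $3$ consisting of $s$ lines, defined by linear forms $\ell_1,\ldots,\ell_s\in R:=\mathbb K[x,y,z]$ with $\gcd(\ell_i,\ell_j)=1$ for $i\neq j$. Let $I:=I_{s-2}(\mathcal A)$ be the ideal of $R$ generated by all $f_{i,j}:=\frac{\ell_1\cdots\ell_s}{\ell_i\ell_j}$, $1\le i<j\le s$. Then the ideal $I$ is of fiber type.
   Context: Rank $3$ means that $\ell_1,\ldots,\ell_s$ span a $3$-dimensional space. Fiber type: let $T:=R[t_{i,j} : 1\le i<j\le s]$, bigraded over $\mathbb K$ by $\deg x=\deg y=\deg z=(1,0)$, $\deg t_{i,j}=(0,1)$. Let $\mathcal I$ be the kernel of the $R$-algebra homomorphism $T\to R[It]$, $t_{i,j}\mapsto f_{i,j}t$, onto the Rees algebra $R[It]\subset R[t]$ of $I$; it is a bihomogeneous ideal, $\mathcal I=\bigoplus_{(u,v)}\mathcal I_{(u,v)}$. Let $\langle \mathcal I_{(-,1)}\rangle$ be the ideal of $T$ generated by the elements of $\mathcal I$ of bidegrees $(u,1)$, $u\ge 0$, and let $\langle \mathcal I_{(0,-)}\rangle$ be the ideal of $T$ generated by the elements of $\mathcal I$ of bidegrees $(0,v)$, $v\ge 0$. The ideal $I$ is said to be of fiber type if $\mathcal I=\langle \mathcal I_{(-,1)}\rangle+\langle \mathcal I_{(0,-)}\rangle$. *)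

(* Defs.v *)
From HB Require Import structures.
From mathcomp Require Import all_boot all_order all_algebra.
From mathcomp Require Import mpoly.

Set Implicit Arguments.
Unset Strict Implicit.
Unset Printing Implicit Defensive.

Import GRing.Theory.
Local Open Scope ring_scope.

Definition ideal_gen (A : comNzRingType) (S : A -> Prop) (a : A) : Prop :=
  exists2 r : seq (A * A),
    (forall p, p \in r -> S p.2) & a = \sum_(p <- r) p.1 * p.2.

Definition ideal_sum (A : comNzRingType) (I J : A -> Prop) (a : A) : Prop :=
  exists b c, [/\ I b, J c & a = b + c].

Definition dvdr (A : comNzRingType) (d a : A) : Prop := exists c, a = d * c.

(* gcd(a, b) = 1 up to units *)
Definition gcd1 (A : comUnitRingType) (a b : A) : Prop :=
  forall d, dvdr d a -> dvdr d b -> d \is a GRing.unit.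

Section FiberType.

Variables (K : fieldType) (m n : nat).

(* R = K[x_0, ..., x_{m-1}] and T = R[t_0, ..., t_{n-1}] *)
Local Notation R := {mpoly K[m]}.
Local Notation T := {mpoly R[n]}.

(* zero has every bidegree, as in any graded component *)
Definition bihomog (u v : nat) (F : T) : Prop :=
  F \is v.-homog /\ forall e : 'X_{1..n}, F@_e \is u.-homog.

Variable f : 'I_n -> R.

(* the R-algebra morphism T -> R[t] sending t_k to f_k t; its image is the
   Rees algebra of the ideal generated by the f_k *)
Definition rees_map (F : T) : {poly R} :=
  mmap (fun c : R => c%:P) (fun k => (f k)%:P * 'X) F.

Definition rees_ideal (F : T) : Prop := rees_map F = 0.

Definition rees_ideal_lin (F : T) : Prop :=
  rees_ideal F /\ exists u, bihomog u 1 F.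

Definition rees_ideal_fib (F : T) : Prop :=
  rees_ideal F /\ exists v, bihomog 0 v F.

Definition fiber_type : Prop :=
  forall F : T, rees_ideal F <->
    ideal_sum (ideal_gen rees_ideal_lin) (ideal_gen rees_ideal_fib) F.

End FiberType.

Notation ord_pair s := {p : 'I_s * 'I_s | (p.1 < p.2)%N}.

(* [dhomog 3 K 1] is the vector space of linear forms in K[x, y, z] *)
Section Products.

Variables (K : fieldType) (s : nat) (l : 'I_s -> dhomog 3 K 1).

(* the quotient l_1 ... l_s / (l_i l_j), for i <> j; see [fprodE] *)
Definition fprod (i j : 'I_s) : {mpoly K[3]} :=
  \prod_(k < s | (k != i) && (k != j)) (l k : {mpoly K[3]}).

Lemma fprodE (i j : 'I_s) : i != j ->
  fprod i j * ((l i : {mpoly K[3]}) * (l j : {mpoly K[3]}))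
  = \prod_(k < s) (l k : {mpoly K[3]}).
Proof.
move=> nij; have nji : j != i by rewrite eq_sym.
by rewrite [RHS](bigD1 i) //= (bigD1 j) //= /fprod mulrC -mulrA.
Qed.

(* the family (f_{i,j}) over i < j, enumerated by an ordinal so that it can
   index the variables of T *)
Definition fgens (k : 'I_#|{: ord_pair s}|) : {mpoly K[3]} :=
  fprod (val (enum_val k)).1 (val (enum_val k)).2.

End Products.

(* Main.v *)
(* Put P = l_1 ... l_s; then f_{i,j} = P / (l_i l_j), so a monomial
   t^e, seen as a multigraph on the lines with v edges, maps to P^v t^v divided
   by the product of the l_i to the powers deg_e(i).  A degree sequence is one
   of a loopless multigraph with v edges exactly when it is bounded by v and
   sums to 2v.  Hence the v-th power of I is generated by the products of
   (s - 2) v of the forms l_i, each being available v times.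

   The heart of the proof determines the syzygies of all a-fold products
   l_S = \prod_(i in S) l_i, |S| = a, of any family of linear forms: they are
   generated by the constant relations \sum_i c_i l_{S + i} = 0, where
   \sum_i c_i l_i = 0, and by the relations l_i l_{S + j} = l_j l_{S + i}, with
   |S| = a - 1.  This goes by deletion and contraction of one form l_n: a syzygy
   modulo l_n comes from the smaller family over R / (l_n), it lifts, and what
   remains is l_n times a syzygy between (a - 1)-fold products.

   Back in T, constant relations have bidegree (0,v), and the others are,
   modulo those, multiples of the linear syzygies l_p t_{p,r} - l_q t_{q,r}. *)

Require Import Defs.
From HB Require Import structures.
From mathcomp Require Import all_boot all_order all_algebra.
From mathcomp Require Import mpoly zify.

Set Implicit Arguments.
Unset Strict Implicit.
Unset Printing Implicit Defensive.

Import GRing.Theory.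
Local Open Scope ring_scope.

(** * Ideals generated by linear forms *)

Section IdealGen.

Variables (A : comNzRingType) (P : A -> Prop).

Lemma ideal_gen0 : ideal_gen P 0.
Proof. by exists [::]; rewrite ?big_nil. Qed.

Lemma ideal_genD a b : ideal_gen P a -> ideal_gen P b -> ideal_gen P (a + b).
Proof.
move=> [r rP ->] [r' rP' ->]; exists (r ++ r'); last by rewrite big_cat.
by move=> p; rewrite mem_cat => /orP[/rP|/rP'].
Qed.

Lemma ideal_genM c a : ideal_gen P a -> ideal_gen P (c * a).
Proof.
move=> [r rP ->]; exists [seq (c * p.1, p.2) | p <- r].
  by move=> p /mapP[q /rP Pq ->].
by rewrite big_map mulr_sumr; apply: eq_bigr => p _; rewrite mulrA.
Qed.

Lemma ideal_gen_in a : P a -> ideal_gen P a.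
Proof.
move=> Pa; exists [:: (1, a)]; last by rewrite big_seq1 mul1r.
by move=> p; rewrite inE => /eqP->.
Qed.

Lemma ideal_gen_min (N : A -> Prop) :
    N 0 -> (forall a b, N a -> N b -> N (a + b)) ->
    (forall c a, P a -> N (c * a)) ->
  forall a, ideal_gen P a -> N a.
Proof.
move=> N0 ND NM a [r rP ->]; rewrite big_seq.
by elim/big_ind: _ => // p /rP; exact: NM.
Qed.

End IdealGen.

Section LinearIdeal.

Variables (K : fieldType) (m : nat).

Local Notation A := {mpoly K[m.+1]}.
Local Notation L := (dhomog m.+1 K 1).

Definition lin_ideal (W : {vspace L}) : A -> Prop :=
  ideal_gen (fun a : A => exists2 w : L, w \in W & a = w).

Lemma linvar_subproof (i : 'I_m.+1) : ('X_i : A) \is 1.-homog.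
Proof. by rewrite dhomogX /= mdeg1. Qed.

Definition linvar i : L := DHomog (linvar_subproof i).

Lemma linform_sum (w : L) : w = \sum_i (w : A)@_(U_(i)) *: linvar i.
Proof.
apply: val_inj => /=; rewrite linear_sum /=.
apply/mpolyP => e; rewrite linear_sum /=.
under eq_bigr do rewrite mcoeffZ mcoeffX.
have [/mdeg1P[i /eqP->]|e1] := boolP (mdeg e == 1%N).
  rewrite (bigD1 i) //= eqxx mulr1 big1 ?addr0 // => j ji.
  case: eqP => [/mnmP/(_ j)|_]; last by rewrite mulr0.
  by rewrite !mnm1E eqxx eq_sym (negbTE ji).
rewrite (dhomog_nemf_coeff (dhomog_is_dhomog w) e1) big1 // => i _.
by case: (U_(i)%MM =P e) => [ie|_]; rewrite ?mulr0 //; rewrite -ie mdeg1 in e1.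
Qed.

Variable W : {vspace L}.

(** The residue along a complement of [W]: this endomorphism of the linear forms has kernel [W] and
    changes a form only by an element of [W]. *)
Definition lin_res (w : L) : L := w - projv W w.

Lemma lin_res_is_linear : linear lin_res.
Proof.
by move=> a u v; rewrite /lin_res linearP scalerBr opprD addrACA.
Qed.

HB.instance Definition _ := GRing.isLinear.Build K L L _ lin_res lin_res_is_linear.

Lemma lin_res_eq0 w : (lin_res w == 0) = (w \in W).
Proof.
apply/idP/idP => [|wW]; last by rewrite /lin_res projv_id ?subrr.
by rewrite subr_eq0 => /eqP->; rewrite memv_proj.
Qed.

Local Notation lin_subst :=
  (comp_mpoly [tuple (lin_res (linvar i) : A) | i < m.+1]).

Lemma lin_subst_linform (w : L) : lin_subst w = lin_res w.
Proof.
rewrite [in LHS](linform_sum w) [in RHS](linform_sum w) !linear_sum /=.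
apply: eq_bigr => i _.
by rewrite !linearZ /= comp_mpolyXU -tnth_nth tnth_mktuple scalerDr.
Qed.

(** The property is stable under sums and products, so it suffices to check constants and variables;
    for a variable the difference is its projection to [W]. *)
Lemma lin_substB p : lin_ideal W (p - lin_subst p).
Proof.
have substM p1 p2 : lin_ideal W (p1 - lin_subst p1) ->
    lin_ideal W (p2 - lin_subst p2) -> lin_ideal W (p1 * p2 - lin_subst (p1 * p2)).
  move=> h1 h2; have -> : p1 * p2 - lin_subst (p1 * p2) =
      p2 * (p1 - lin_subst p1) + lin_subst p1 * (p2 - lin_subst p2).
    by rewrite rmorphM !mulrBr addrA (mulrC p2) (mulrC p2) subrK.
  by apply: ideal_genD; apply: ideal_genM.
have subst1 : lin_ideal W (1 - lin_subst 1).
  by rewrite rmorph1 subrr; apply: ideal_gen0.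
elim/mpolyind: p => [|c e p _ _ IH].
  by rewrite rmorph0 subr0; apply: ideal_gen0.
rewrite rmorphD opprD addrACA; apply: ideal_genD => //.
rewrite -mul_mpolyC; apply: (substM).
  by rewrite comp_mpolyC subrr; apply: ideal_gen0.
rewrite mpolyXE_id.
apply: (big_ind (fun q => lin_ideal W (q - lin_subst q))) => // i _.
elim: (e i) => [|k IHk] //.
rewrite exprS; apply: (substM) => //.
apply: ideal_gen_in; exists (projv W (linvar i)); first exact: memv_proj.
by rewrite (lin_subst_linform (linvar i)) /= subKr.
Qed.

(* Ideals generated by linear forms are thus kernels of linear substitutions,
   hence prime. *)
Lemma lin_idealP p : lin_ideal W p <-> lin_subst p = 0.
Proof.
split=> [|p0]; last by have := lin_substB p; rewrite p0 subr0.
apply: (ideal_gen_min (N := fun p => lin_subst p = 0)) => [|a b a0 b0|c _ [w wW ->]].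
- exact: rmorph0.
- by rewrite rmorphD /= a0 b0 addr0.
rewrite rmorphM /= lin_subst_linform.
by move: wW; rewrite -lin_res_eq0 => /eqP->; rewrite mulr0.
Qed.

Lemma lin_ideal_prime (w : L) p : lin_ideal W ((w : A) * p) ->
  w \notin W -> lin_ideal W p.
Proof.
move=> /lin_idealP; rewrite rmorphM /= lin_subst_linform => /eqP.
rewrite mulf_eq0 => /orP[/eqP w0|/eqP p0 _]; last exact/lin_idealP.
by rewrite -lin_res_eq0 (_ : lin_res w = 0) ?eqxx //; apply: val_inj.
Qed.

Lemma lin_ideal_addv (w : L) p : lin_ideal W p -> lin_ideal (W + <[w]>) p.
Proof.
apply: (ideal_gen_min (N := lin_ideal _)) => [|a b|c _ [u uW ->]].
  exact: ideal_gen0.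
  exact: ideal_genD.
by apply/ideal_genM/ideal_gen_in; exists u => //; apply: subvP uW; exact: addvSl.
Qed.

End LinearIdeal.

(** * Syzygies of products of linear forms *)

Lemma sum_ksubsetsD1 (V : nmodType) (I : finType) (E : {set I}) (n : I) (a : nat)
    (F : {set I} -> V) : n \in E ->
  \sum_(S : {set I} | (S \subset E) && (#|S| == a.+1)) F S =
    \sum_(S : {set I} | (S \subset E :\ n) && (#|S| == a)) F (n |: S) +
    \sum_(S : {set I} | (S \subset E :\ n) && (#|S| == a.+1)) F S.
Proof.
move=> nE; rewrite (bigID (fun S : {set I} => n \in S)) /=; congr (_ + _).
  rewrite (reindex_onto (fun S => n |: S) (fun S => S :\ n)) /=; last first.
    by move=> S /andP[_ nS]; rewrite setD1K.
  apply: eq_bigl => S; rewrite subUset sub1set nE /= setU11 andbT subsetD1.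
  have [nS|nS] /= := boolP (n \in S).
    rewrite andbF; apply/negbTE/negP => /andP[_ /eqP eS].
    by move: nS; rewrite -eS setD11.
  by rewrite setU1K // eqxx !andbT cardsU1 nS add1n eqSS.
by apply: eq_bigl => S; rewrite subsetD1 andbAC.
Qed.

Lemma sum_setDD1 (V : nmodType) (I : finType) (E S : {set I}) (n : I) (F : I -> V) :
  n \in E -> n \notin S ->
  \sum_(i in E :\: S) F i = F n + \sum_(i in E :\ n :\: S) F i.
Proof.
move=> nE nS; rewrite (bigD1 n) /=; last by rewrite inE nS.
by congr (_ + _); apply: eq_bigl => i; rewrite !inE andbCA andbC.
Qed.

Section Syzygies.

Variables (K : fieldType) (m : nat) (I : finType) (l : I -> dhomog m.+1 K 1).

Local Notation A := {mpoly K[m.+1]}.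
Local Notation L := (dhomog m.+1 K 1).

Definition lprod (S : {set I}) : A := \prod_(i in S) (l i : A).

Lemma lprodU1 i (S : {set I}) : i \notin S -> lprod (i |: S) = (l i : A) * lprod S.
Proof. exact: big_setU1. Qed.

Record submodule (M : lmodType A) (N : M -> Prop) : Prop := Submodule {
  submod0 : N 0;
  submodD : forall x y, N x -> N y -> N (x + y);
  submodZ : forall c x, N x -> N (c *: x) }.

Lemma submodN (M : lmodType A) (N : M -> Prop) x : submodule N -> N x -> N (- x).
Proof. by move=> sN Nx; rewrite -scaleN1r; apply: submodZ. Qed.

Lemma submod_sum (M : lmodType A) (N : M -> Prop) (J : Type) (r : seq J)
    (P : pred J) (F : J -> M) :
  submodule N -> (forall j, P j -> N (F j)) -> N (\sum_(j <- r | P j) F j).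
Proof. by move=> sN NF; apply: (big_ind N) => //; [apply: submod0|apply: submodD]. Qed.

(* Instead of generating a module of syzygies, we let [phi] be any family that
   satisfies the expected generators modulo [N]; [syzygy_gen] then says that it
   satisfies every syzygy.  The forms in [W] are those already set to 0. *)
Record respects (E : {set I}) (a : nat) (W : {vspace L}) (M : lmodType A)
    (N : M -> Prop) (phi : {set I} -> M) : Prop := Respects {
  resp_lin : forall (S : {set I}) (c : I -> K), S \subset E -> #|S|.+1 = a ->
    \sum_(i in E :\: S) c i *: l i \in W ->
    N (\sum_(i in E :\: S) (c i)%:MP *: phi (i |: S));
  resp_koszul : forall (S : {set I}) i j, S \subset E -> #|S|.+1 = a ->
    i \in E :\: S -> j \in E :\: S ->
    N ((l i : A) *: phi (j |: S) - (l j : A) *: phi (i |: S));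
  resp_ann : forall (S : {set I}) (w : L), S \subset E -> #|S| = a ->
    w \in W -> N ((w : A) *: phi S) }.

(** The complement of [S] in [E :\ n] is that of [n |: S] in [E], so each relation required at [S]
    is one that [phi] satisfies at [n |: S]. *)
Lemma resp_del (E : {set I}) n a W (M : lmodType A) (N : M -> Prop) phi :
  n \in E -> respects E a.+1 W N phi ->
  respects (E :\ n) a W N (fun S => phi (n |: S)).
Proof.
move=> nE [lin koszul ann].
have sub (S : {set I}) : S \subset E :\ n -> (n |: S \subset E) * (n \notin S).
  by rewrite subsetD1 => /andP[SE nS]; rewrite subUset sub1set nE SE.
have setDE (S : {set I}) : E :\: (n |: S) = E :\ n :\: S by rewrite setDDl.
split=> [S c /sub[SE nS] Sa cW|S i j /sub[SE nS] Sa iE jE|S w /sub[SE nS] Sa wW].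
- have := lin (n |: S) c SE; rewrite cardsU1 nS add1n Sa setDE => /(_ erefl cW).
  by under eq_bigr do rewrite setUCA.
- have := koszul (n |: S) i j SE; rewrite cardsU1 nS add1n Sa setDE.
  by move/(_ erefl iE jE); rewrite !(setUCA _ [set n]).
by apply: ann => //; rewrite cardsU1 nS Sa.
Qed.

(** Isolating the coefficient [b] of [n] serves for deletion ([b = 0]), for the case that [l n] lies
    in [W] ([b = 1]), and for contraction. *)
Lemma resp_linD1 (E S : {set I}) n a (W : {vspace L}) (M : lmodType A)
    (N : M -> Prop) phi b (c : I -> K) : n \in E -> respects E a W N phi ->
  S \subset E :\ n -> #|S|.+1 = a ->
  b *: l n + \sum_(i in E :\ n :\: S) c i *: l i \in W ->
  N (b%:MP *: phi (n |: S) + \sum_(i in E :\ n :\: S) (c i)%:MP *: phi (i |: S)).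
Proof.
move=> nE [lin _ _]; rewrite subsetD1 => /andP[SE nS] Sa.
have := lin S (fun i => if i == n then b else c i) SE Sa.
rewrite !(sum_setDD1 _ nE nS) eqxx => linS cW.
have neqn i : i \in E :\ n :\: S -> (i == n) = false.
  by rewrite !inE; case/and3P => _ /negbTE.
rewrite (eq_bigr (fun i => (if i == n then b else c i)%:MP *: phi (i |: S))).
  apply: linS; rewrite (eq_bigr (fun i => c i *: l i)) // => i iE.
  by rewrite neqn.
by move=> i iE; rewrite neqn.
Qed.

Lemma resp_delr (E : {set I}) n a (W : {vspace L}) (M : lmodType A)
    (N : M -> Prop) phi : n \in E ->
  respects E a W N phi -> respects (E :\ n) a W N phi.
Proof.
move=> nE rphi; have [_ koszul ann] := rphi.
have sub (S : {set I}) : S \subset E :\ n -> S \subset E.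
  by rewrite subsetD1 => /andP[].
have inD (S : {set I}) i : i \in E :\ n :\: S -> i \in E :\: S.
  by rewrite !inE; case/and3P => -> _ ->.
split=> [S c SE Sa cW|S i j /sub SE Sa iE jE|S w /sub SE Sa wW].
- have := resp_linD1 (b := 0) (c := c) nE rphi SE Sa.
  by rewrite mpolyC0 !scale0r !add0r; apply.
- by apply: koszul => //; apply: inD.
exact: ann.
Qed.

(** * Contraction: relations modulo [l n] *)

Section Contraction.

Variables (E : {set I}) (n : I) (a : nat) (W : {vspace L}).
Variables (M : lmodType A) (N : M -> Prop) (phi : {set I} -> M).
Hypotheses (nE : n \in E) (sN : submodule N) (rphi : respects E a.+1 W N phi).

Local Notation sumn F := (\sum_(S : {set I} | (S \subset E :\ n) && (#|S| == a)) F S).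

(* The second component keeps track of the value of a formal combination, so
   that a relation obtained modulo [l n] can be lifted to an actual one. *)
Definition contr (x : M * A^o) : Prop := exists h : {set I} -> A,
  N (x.1 - sumn (fun S => h S *: phi (n |: S))) /\
  lin_ideal W (x.2 - sumn (fun S => h S * lprod (n |: S))).

Lemma contr1 (S : {set I}) b x y : S \subset E :\ n -> #|S| = a ->
  N (x - b *: phi (n |: S)) -> lin_ideal W (y - b * lprod (n |: S)) -> contr (x, y).
Proof.
move=> SE Sa Nx Wy; exists (fun T => if T == S then b else 0) => /=.
have pick (V : nmodType) (F : {set I} -> V) :
    (forall T, T != S -> F T = 0) -> sumn F = F S.
  move=> F0; rewrite (bigD1 S) ?SE ?Sa ?eqxx //= big1 ?addr0 // => T /andP[_].
  exact: F0.
by rewrite !pick ?eqxx // => T /negbTE->; rewrite ?scale0r ?mul0r.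
Qed.

Lemma contr0 x y : N x -> lin_ideal W y -> contr (x, y).
Proof.
by move=> Nx Wy; exists (fun=> 0) => /=; rewrite !big1 ?subr0 // => S _;
   rewrite ?scale0r ?mul0r.
Qed.

Lemma submodule_contr : submodule contr.
Proof.
split=> [|x y [h [Nx Wx]] [h' [Ny Wy]]|c x [h [Nx Wx]]].
- by apply: contr0; [apply: submod0|apply: ideal_gen0].
- exists (fun S => h S + h' S) => /=; split.
    under eq_bigr do rewrite scalerDl.
    by rewrite big_split opprD addrACA; apply: submodD.
  under eq_bigr do rewrite mulrDl.
  by rewrite big_split opprD addrACA; apply: ideal_genD.
exists (fun S => c * h S) => /=; split.
  under eq_bigr do rewrite -scalerA.
  by rewrite -scaler_sumr -scalerBr; apply: submodZ.
under eq_bigr do rewrite -mulrA.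
by rewrite -mulr_sumr -mulrBr; apply: ideal_genM.
Qed.

(** A relation modulo [l n] leaves an error divisible by [l n], which [contr] absorbs into terms
    indexed by sets containing [n]. A linear relation with value [b *: l n] modulo [W] leaves the
    single term [b] at [n |: S]; Koszul relations leave none. *)
Lemma resp_contr : respects (E :\ n) a.+1 (W + <[l n]>) contr
  (fun S => (phi S, lprod S) : M * A^o).
Proof.
have [_ koszul ann] := rphi.
have sub (S : {set I}) : S \subset E :\ n -> (S \subset E) * (n \notin S).
  by rewrite subsetD1 => /andP[SE nS].
have inD (S : {set I}) i : i \in E :\ n :\: S -> (i \in E :\: S) * (i \notin S).
  by rewrite !inE; case/and3P => -> _ ->.
have linW (w : L) b : w \in W -> lin_ideal W ((w : A) * b).
  by move=> wW; rewrite mulrC; apply/ideal_genM/ideal_gen_in; exists w.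
split=> [S c SEn [Sa]|S i j SEn [Sa] iE jE|S w SEn Sa].
- have [SE nS] := sub S SEn.
  move=> /memv_addP[w wW [_ /vlineP[b ->] cE]].
  have cE' : - b *: l n + \sum_(i in E :\ n :\: S) c i *: l i = w.
    by rewrite cE scaleNr addrC addrK.
  rewrite [X in contr X]surjective_pairing (raddf_sum fst) (raddf_sum snd) /=.
  apply: (contr1 (S := S) (b := b%:MP)) => //.
    rewrite addrC -scaleNr -mpolyCN; apply: (resp_linD1 nE rphi) => //.
      by rewrite Sa.
    by rewrite cE'.
  rewrite (_ : _ - _ = (w : A) * lprod S); first exact: linW.
  rewrite -cE' lprodU1 //= linear_sum /= mulrDl addrC.
  rewrite scaleNr mulNr -scalerAl mul_mpolyC; congr (_ + _).
  rewrite mulr_suml; apply: eq_bigr => i /inD[_ iS].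
  by rewrite lprodU1 // -scalerAl -mul_mpolyC.
- have [SE nS] := sub S SEn; have [iES iS] := inD _ _ iE; have [jES jS] := inD _ _ jE.
  apply: contr0; first by apply: koszul => //; rewrite Sa.
  rewrite /= !lprodU1 // /GRing.scale /= mulrCA subrr; exact: ideal_gen0.
have [SE nS] := sub S SEn.
move=> /memv_addP[u uW [_ /vlineP[b ->] ->]].
(* As [S] is nonempty, the Koszul relation at [S :\ i] turns [l n] times [phi S] into [l i] times
   [phi (n |: (S :\ i))] modulo [N], an admissible term. *)
have [i iS] : exists i, i \in S by apply/card_gt0P; rewrite Sa.
have iSi : i \notin S :\ i by rewrite setD11.
have nSi : n \notin S :\ i by rewrite inE (negbTE nS) andbF.
have SiE : S :\ i \subset E := subset_trans (subD1set _ _) SE.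
have SiEn : S :\ i \subset E :\ n := subset_trans (subD1set _ _) SEn.
have Si : #|S :\ i|.+1 = a.+1 by rewrite -Sa [RHS](cardsD1 i) iS.
have iE : i \in E :\: (S :\ i) by rewrite inE iSi (subsetP SE).
have nEi : n \in E :\: (S :\ i) by rewrite inE nSi.
apply: (contr1 (S := S :\ i) (b := b *: (l i : A))
  (y := ((u : A) + b *: (l n : A)) * lprod S)) => //=; first by case: Si.
  have := koszul _ n i SiE Si nEi iE; rewrite setD1K // => Nk.
  rewrite scalerDl -addrA -!mul_mpolyC -!scalerA -scalerBr.
  by apply: submodD => //; [apply: ann|apply: submodZ].
rewrite -{1}(setD1K iS) !lprodU1 // (_ : _ - _ = (u : A) * ((l i : A) * lprod (S :\ i))).
  exact: linW.
rewrite mulrDl -!scalerAl (mulrCA (l i : A)).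
by rewrite addrK.
Qed.

End Contraction.
Lemma resp_ann_ideal (E S : {set I}) a (W : {vspace L}) (M : lmodType A)
    (N : M -> Prop) phi p : submodule N -> respects E a W N phi ->
  S \subset E -> #|S| = a -> lin_ideal W p -> N (p *: phi S).
Proof.
move=> sN [_ _ ann] SE Sa.
apply: (ideal_gen_min (N := fun p => N (p *: phi S))) => [|b c|c _ [w wW ->]].
- by rewrite scale0r; apply: submod0.
- by rewrite scalerDl; apply: submodD.
by rewrite -scalerA; apply: submodZ => //; apply: ann.
Qed.

Lemma syzygy_gen0 (E : {set I}) a (W : {vspace L}) (M : lmodType A)
    (N : M -> Prop) (phi : {set I} -> M) (g : {set I} -> A) :
  a = 0%N -> submodule N -> respects E a W N phi ->
  lin_ideal W (\sum_(S : {set I} | (S \subset E) && (#|S| == a)) g S * lprod S) ->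
  N (\sum_(S : {set I} | (S \subset E) && (#|S| == a)) g S *: phi S).
Proof.
move=> -> sN rphi.
have pred_set0 (S : {set I}) : (S \subset E) && (#|S| == 0) = (S == set0).
  by rewrite cards_eq0; case: eqP => [->|]; rewrite ?sub0set ?andbF.
rewrite !(big_pred1 set0) //= /lprod big_set0 mulr1.
exact: (resp_ann_ideal sN rphi (sub0set E) (cards0 I)).
Qed.

(** Induction on the size of [E], with [M], [N] and [phi] left general because the contraction step
    applies the claim to [M * A^o]. *)
Lemma syzygy_gen (E : {set I}) (a : nat) (W : {vspace L}) (M : lmodType A)
    (N : M -> Prop) (phi : {set I} -> M) (g : {set I} -> A) :
  submodule N -> respects E a W N phi ->
  lin_ideal W (\sum_(S : {set I} | (S \subset E) && (#|S| == a)) g S * lprod S) ->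
  N (\sum_(S : {set I} | (S \subset E) && (#|S| == a)) g S *: phi S).
Proof.
move: {2}#|E| (erefl #|E|) => k.
elim: k => [|k IHk] in E a W M N phi g * => Ek sN rphi gW;
  have [a0|a_gt0] := posnP a.
- by apply: syzygy_gen0 rphi _.
- rewrite big1 => [|S /andP[SE /eqP Sa]]; first exact: submod0.
  by have := subset_leq_card SE; rewrite Ek Sa leqNgt a_gt0.
- by apply: syzygy_gen0 rphi _.
case: a a_gt0 rphi gW => // a _ rphi gW.
have [n nE] : exists n, n \in E by apply/card_gt0P; rewrite Ek.
have Enk : #|E :\ n| = k by move: Ek; rewrite (cardsD1 n) nE => -[].
rewrite !(sum_ksubsetsD1 a _ nE) in gW *.
have IdB p q : lin_ideal W p -> lin_ideal W q -> lin_ideal W (p - q).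
  by move=> Wp Wq; apply: ideal_genD => //; rewrite -mulN1r; apply: ideal_genM.
have lprod_n (f : {set I} -> A) :
    \sum_(S : {set I} | (S \subset E :\ n) && (#|S| == a)) f S * lprod (n |: S) =
    (l n : A) * \sum_(S : {set I} | (S \subset E :\ n) && (#|S| == a)) f S * lprod S.
  rewrite mulr_sumr; apply: eq_bigr => S; rewrite subsetD1 => /andP[/andP[_ nS] _].
  by rewrite lprodU1 // mulrCA.
(* If [l n] is already zero modulo [W], the linear relation with sole coefficient 1 at [n] puts
   [phi (n |: S)] in [N], and deletion handles the remaining terms. *)
have [nW|nW] := boolP (l n \in W).
  apply: submodD => //.
    apply: submod_sum => // S /andP[SE /eqP Sa]; apply: submodZ => //.
    have := resp_linD1 (b := 1) (c := fun=> 0) nE rphi SE.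
    rewrite Sa mpolyC1 !scale1r !big1 ?addr0; first by apply.
      by move=> i _; rewrite mpolyC0 scale0r.
    by move=> i _; rewrite scale0r.
  apply: (IHk _ _ _ _ _ _ _ Enk sN (resp_delr nE rphi)).
  rewrite -[X in lin_ideal W X](addKr
    (\sum_(S : {set I} | (S \subset E :\ n) && (#|S| == a)) g (n |: S) * lprod (n |: S))) addrC.
  apply: IdB => //; rewrite lprod_n mulrC.
  by apply/ideal_genM/ideal_gen_in; exists (l n).
(* Modulo [l n] the products containing [n] vanish, so the terms without [n] form a syzygy of the
   contracted family. *)
have := IHk _ _ _ _ _ _ g Enk (submodule_contr E n a W phi sN)
  (resp_contr nE sN rphi).
case.
  rewrite -[X in lin_ideal _ X](addKr
    (\sum_(S : {set I} | (S \subset E :\ n) && (#|S| == a)) g (n |: S) * lprod (n |: S))) addrC.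
  apply: ideal_genD; first exact: lin_ideal_addv.
  rewrite lprod_n mulrC -mulNr; apply/ideal_genM/ideal_gen_in.
  by exists (l n) => //; rewrite (subvP (addvSr _ _)) ?memv_line.
move=> h []; rewrite (raddf_sum fst) (raddf_sum snd) /= => Nh Wh.
(* Now [h] rewrites the terms without [n] as terms with [n]; the whole value becomes [l n] times a
   combination of [a]-fold products, and primality cancels [l n]. *)
have Wgh : lin_ideal W (\sum_(S : {set I} | (S \subset E :\ n) && (#|S| == a))
    (g (n |: S) + h S) * lprod S).
  apply: lin_ideal_prime nW; rewrite -lprod_n.
  under eq_bigr do rewrite mulrDl.
  rewrite big_split /=; have := IdB _ _ gW Wh.
  by rewrite opprB addrACA subrr addr0.
have := IHk _ _ _ _ _ _ _ Enk sN (resp_del nE rphi) Wgh.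
move=> /(submodD sN) /(_ Nh).
under [X in N (X + (_ - _))]eq_bigr do rewrite scalerDl.
by rewrite big_split /= addrACA subrr addr0.
Qed.

End Syzygies.

(** * Degree sequences of multigraphs *)

Section Multigraphs.

Variable s : nat.

Local Notation n := #|{: ord_pair s}|.

Definition incident (k : 'I_n) (i : 'I_s) : bool :=
  (i == (val (enum_val k)).1) || (i == (val (enum_val k)).2).

(* A monomial in the [t_{i,j}] is a loopless multigraph on the lines. *)
Definition gdeg (e : 'X_{1..n}) (i : 'I_s) : nat := (\sum_k incident k i * e k)%N.

Lemma edge_exists (p q : 'I_s) : p != q ->
  exists k, forall i, incident k i = (i == p) || (i == q).
Proof.
move=> npq.
have [pq|qp] : (p < q)%N \/ (q < p)%N by move: npq; rewrite -val_eqE /=; lia.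
  by exists (enum_rank (exist _ (p, q) pq : ord_pair s)) => i; rewrite /incident enum_rankK.
exists (enum_rank (exist _ (q, p) qp : ord_pair s)) => i.
by rewrite /incident enum_rankK /= orbC.
Qed.

Lemma gdegD e e' i : gdeg (e + e')%MM i = (gdeg e i + gdeg e' i)%N.
Proof. by rewrite /gdeg -big_split /=; apply: eq_bigr => k _; rewrite mnmDE mulnDr. Qed.

Lemma gdegU k i : gdeg U_(k)%MM i = incident k i.
Proof.
rewrite /gdeg (bigD1 k) //= mnm1E eqxx muln1 big1 ?addn0 // => j jk.
by rewrite mnm1E eq_sym (negbTE jk) muln0.
Qed.

Lemma gdeg_le e i : (gdeg e i <= mdeg e)%N.
Proof. by rewrite mdegE; apply: leq_sum => k _; case: incident; rewrite ?mul1n. Qed.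

Lemma sum_eq1 (p : 'I_s) : (\sum_(i < s) (i == p) = 1)%N.
Proof. by rewrite (bigD1 p) //= eqxx big1 // => i /negbTE->. Qed.

Lemma sum_gdeg e : (\sum_i gdeg e i = 2 * mdeg e)%N.
Proof.
rewrite exchange_big mdegE big_distrr /=; apply: eq_bigr => k _.
rewrite -big_distrl /=; congr (_ * _)%N.
have ltk : (val (enum_val k)).1 != (val (enum_val k)).2.
  by rewrite -val_eqE /= neq_ltn (valP (enum_val k)).
rewrite -[2%N]/(1 + 1)%N -{1}(sum_eq1 (val (enum_val k)).1).
rewrite -(sum_eq1 (val (enum_val k)).2) -big_split /=; apply: eq_bigr => i _.
rewrite /incident; have [->|//] := eqVneq i; by rewrite (negbTE ltk).
Qed.

Lemma sum3_le (d : 'I_s -> nat) (p q r : 'I_s) : uniq [:: p; q; r] ->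
  (d p + d q + d r <= \sum_i d i)%N.
Proof.
rewrite /= !inE negb_or => /and3P[/andP[pq pr] qr _].
rewrite (bigD1 p) //= (bigD1 q) 1?eq_sym //= (bigD1 r) /=.
  by rewrite !addnA leq_addr.
by rewrite ![r == _]eq_sym pr qr.
Qed.

(** Remove an edge joining two vertices [p] and [q] of largest degree. The other degrees respect the
    lowered bound: one equal to the old bound would force three such degrees, whose sum exceeds
    twice that bound. *)
Lemma multigraph_exists v (d : 'I_s -> nat) :
  (forall i, d i <= v)%N -> (\sum_i d i = 2 * v)%N ->
  exists e : 'X_{1..n}, mdeg e = v /\ forall i, gdeg e i = d i.
Proof.
elim: v => [|v IHv] in d *; move=> dv sd.
  exists 0%MM; rewrite mdeg0; split=> // i; move: (dv i).
  by rewrite leqn0 => /eqP->; rewrite /gdeg big1 // => k _; rewrite mnm0E muln0.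
have [i0 _] : exists i : 'I_s, true.
  case: s d dv sd {IHv} => [|s'] d _; last by exists ord0.
  by rewrite big_ord0.
have [p _ pmax] := @arg_maxnP _ i0 xpredT d isT.
have [j jp] : exists j, j != p.
  apply/existsP; apply: contraT; rewrite negb_exists => /forallP /= allp.
  move: sd; rewrite (bigD1 p) //= big1 => [|i]; first by have := dv p; lia.
  by rewrite -[_ != _]negbK (negbTE (allp i)).
have [q qp qmax] := @arg_maxnP _ j (fun i => i != p) d jp.
have dq : (0 < d q)%N.
  rewrite lt0n; apply/negP => /eqP q0.
  move: sd; rewrite (bigD1 p) //= big1 => [|i ip]; first by have := dv p; lia.
  by have := qmax i ip; rewrite q0; lia.
have dp : (d q <= d p)%N by apply: pmax.
pose d' i := (d i - ((i == p) + (i == q)))%N.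
have dE i : d i = (d' i + ((i == p) + (i == q)))%N.
  rewrite /d' subnK //; have [->|_] := eqVneq i p.
    by rewrite eq_sym (negbTE qp); lia.
  by have [->|_] := eqVneq i q.
have [i||e [ev ed]] := IHv d'.
- rewrite /d'; have [->|ip] := eqVneq i p; first by have := dv p; lia.
  have [->|iq] := eqVneq i q; first by have := dv q; lia.
  have : uniq [:: p; q; i].
    by rewrite /= !inE negb_or (eq_sym p q) (eq_sym p i) (eq_sym q i) qp ip iq.
  by move/(sum3_le d); rewrite sd; have := qmax i ip; lia.
- move: sd; rewrite (eq_bigr _ (fun i _ => dE i)) !big_split /= !sum_eq1; lia.
have [k kE] : exists k, forall i, incident k i = (i == p) || (i == q).
  by apply: edge_exists; rewrite eq_sym.
exists (e + U_(k))%MM; rewrite mdegD mdeg1 ev addn1; split=> // i.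
rewrite gdegD ed gdegU kE dE; have [->|] := eqVneq i p => //.
by rewrite eq_sym (negbTE qp).
Qed.

(** This links [d] lowered at [p] and [d] lowered at [q]: they are the degrees of a common [e] plus
    the edge from [r] to [q], respectively to [p]. An [r] of largest degree apart from [p] and [q]
    works, as a further vertex of degree [v] would make the sum at least [2 * v + 2]. *)
Lemma third_vertex v (d : 'I_s -> nat) (p q : 'I_s) : p != q ->
  (forall i, d i <= v)%N -> (0 < d p)%N -> (0 < d q)%N ->
  (\sum_i d i = (2 * v).+1)%N ->
  exists r, [/\ r != p, r != q & exists e : 'X_{1..n}, (mdeg e).+1 = v /\
    forall i, d i = (gdeg e i + ((i == p) + (i == q) + (i == r)))%N].
Proof.
move=> pq dv dp dq sd.
have [j /andP[jp jq]] : exists j, (j != p) && (j != q).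
  apply/existsP; apply: contraT; rewrite negb_exists => /forallP /= allpq.
  move: sd; rewrite (bigD1 p) //= (bigD1 q) 1?eq_sym //= big1 => [|i].
    by have := dv p; have := dv q; lia.
  by rewrite (negbTE (allpq i)).
have [r /andP[rp rq] rmax] := @arg_maxnP _ j (fun i => (i != p) && (i != q)) d
  (introT andP (conj jp jq)).
have dr : (0 < d r)%N.
  rewrite lt0n; apply/negP => /eqP r0.
  move: sd; rewrite (bigD1 p) //= (bigD1 q) 1?eq_sym //= big1 => [|i ipq].
    by have := dv p; have := dv q; lia.
  by have := rmax i ipq; rewrite r0; lia.
exists r; split=> //.
pose d' i := (d i - ((i == p) + (i == q) + (i == r)))%N.
have dE i : d i = (d' i + ((i == p) + (i == q) + (i == r)))%N.
  rewrite /d' subnK //; have [->|ip] := eqVneq i p.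
    by rewrite (negbTE pq) eq_sym (negbTE rp); lia.
  have [->|iq] := eqVneq i q; first by rewrite eq_sym (negbTE rq); lia.
  by have [->|_] := eqVneq i r; lia.
have [i||e [ev ed]] := @multigraph_exists v.-1 d'.
- rewrite /d'; have [->|ip] := eqVneq i p; first by have := dv p; lia.
  have [->|iq] := eqVneq i q; first by have := dv q; lia.
  have [->|ir] := eqVneq i r; first by have := dv r; lia.
  have : (d p + d q + d r + d i <= \sum_i d i)%N.
    rewrite (bigD1 p) //= (bigD1 q) 1?eq_sym //= (bigD1 r) ?rp ?rq //=.
    by rewrite (bigD1 i) ?ip ?iq //=; lia.
  by have := rmax i; rewrite ip iq sd => /(_ isT); have := dv i; lia.
- move: sd; rewrite (eq_bigr _ (fun i _ => dE i)) !big_split /= !sum_eq1.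
  by have := dv p; lia.
exists e; split=> [|i]; last by rewrite ed.
by rewrite ev prednK //; have := dv p; lia.
Qed.

End Multigraphs.

(** * The Rees ideal *)

Section ReesMap.

Variables (K : fieldType) (m n : nat) (f : 'I_n -> {mpoly K[m]}).

Local Notation T := {mpoly {mpoly K[m]}[n]}.

HB.instance Definition _ := GRing.isAdditive.Build T {poly {mpoly K[m]}}
  (rees_map f) (@mmap_is_additive _ _ _ _ _).
HB.instance Definition _ := GRing.isMultiplicative.Build T {poly {mpoly K[m]}}
  (rees_map f) (@mmap_is_multiplicative _ _ _ _ _).

Lemma rees_mapZ c F : rees_map f (c *: F) = c%:P * rees_map f F.
Proof. exact: mmapZ. Qed.

Lemma rees_mapX e :
  rees_map f 'X_[e] = (\prod_k f k ^+ e k)%:P * 'X^(mdeg e).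
Proof.
rewrite /rees_map mmapX /mmap1 mdegE -prodrXr rmorph_prod -big_split /=.
by apply: eq_bigr => k _; rewrite exprMn rmorphXn.
Qed.

Lemma coef_rees_map F v : (rees_map f F)`_v =
  \sum_(e <- msupp F | mdeg e == v) F@_e * \prod_k f k ^+ e k.
Proof.
rewrite [in LHS](mpolyE F) raddf_sum coef_sum /= [RHS]big_mkcond /=.
apply: eq_bigr => e _; rewrite rees_mapZ rees_mapX mulrA -polyCM coefCM coefXn.
by rewrite eq_sym; case: eqP; rewrite ?mulr1 ?mulr0.
Qed.

Definition fiber_ideal (F : T) : Prop :=
  ideal_sum (ideal_gen (rees_ideal_lin f)) (ideal_gen (rees_ideal_fib f)) F.

Lemma fiber_ideal_lin F : ideal_gen (rees_ideal_lin f) F -> fiber_ideal F.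
Proof. by move=> linF; exists F, 0; rewrite addr0; split=> //; apply: ideal_gen0. Qed.

Lemma fiber_ideal_fib F : ideal_gen (rees_ideal_fib f) F -> fiber_ideal F.
Proof. by move=> fibF; exists 0, F; rewrite add0r; split=> //; apply: ideal_gen0. Qed.

Lemma fiber_idealD F G : fiber_ideal F -> fiber_ideal G -> fiber_ideal (F + G).
Proof.
move=> [a [b [la fb ->]]] [a' [b' [la' fb' ->]]]; exists (a + a'), (b + b').
by split; [apply: ideal_genD|apply: ideal_genD|rewrite addrACA].
Qed.

Lemma fiber_idealM G F : fiber_ideal F -> fiber_ideal (G * F).
Proof.
move=> [a [b [la fb ->]]]; exists (G * a), (G * b).
by split; [apply: ideal_genM|apply: ideal_genM|rewrite mulrDr].
Qed.

Lemma fiber_ideal_rees F : fiber_ideal F -> rees_ideal f F.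
Proof.
have gen P a : (forall b : T, P b -> rees_ideal f b) -> ideal_gen P a -> rees_ideal f a.
  move=> Pr; apply: (ideal_gen_min (N := rees_ideal f)) => [|x y|c x /Pr].
  - exact: rmorph0.
  - by rewrite /rees_ideal rmorphD /= => -> ->; rewrite addr0.
  by rewrite /rees_ideal rmorphM /= => ->; rewrite mulr0.
move=> [a [b [la fb ->]]]; rewrite /rees_ideal rmorphD /=.
have -> : rees_map f a = 0 by apply: gen la => x [].
have -> : rees_map f b = 0 by apply: gen fb => x [].
by rewrite addr0.
Qed.

End ReesMap.

Lemma submodule_fiber_ideal (K : fieldType) m n (f : 'I_n -> {mpoly K[m.+1]}) :
  submodule (fiber_ideal f).
Proof.
split=> [|F G|c F]; [|exact: fiber_idealD|].
  exact/fiber_ideal_lin/ideal_gen0.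
by rewrite -mul_mpolyC; apply: fiber_idealM.
Qed.

(** * Copies of the lines, their multigraphs, and fiber type *)

Section Lines.

Variables (K : fieldType) (s : nat) (l : 'I_s -> dhomog 3 K 1).

Local Notation n := #|{: ord_pair s}|.
Local Notation R := {mpoly K[3]}.
Local Notation T := {mpoly R[n]}.

Lemma fgensE k : fgens l k = \prod_(i | ~~ incident k i) (l i : R).
Proof. by apply: eq_bigl => i; rewrite /incident negb_or. Qed.

(** [mdeg e - gdeg e i] counts the edges avoiding [i], which are those whose generator has the
    factor [l i]. *)
Lemma prod_fgens (e : 'X_{1..n}) :
  \prod_k fgens l k ^+ e k = \prod_i (l i : R) ^+ (mdeg e - gdeg e i).
Proof.
have -> : \prod_k fgens l k ^+ e k = \prod_k \prod_i (l i : R) ^+ (~~ incident k i * e k).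
  apply: eq_bigr => k _; rewrite fgensE -prodrXl big_mkcond; apply: eq_bigr => i _.
  by case: incident => //=; rewrite mul1n.
rewrite exchange_big /=; apply: eq_bigr => i _; rewrite prodrXr; congr (_ ^+ _).
rewrite mdegE /gdeg -sumnB => [|k _]; last by case: incident; rewrite ?mul1n.
by apply: eq_bigr => k _; case: incident => /=; lia.
Qed.

Variable v : nat.

Local Notation I := ('I_s * 'I_v)%type.
Implicit Types (S : {set I}) (x y : I) (e : 'X_{1..n}).

(** Each line has [v] copies, so that products with exponents at most [v] become products over
    subsets, the setting of [syzygy_gen]. *)
Definition line_of (x : I) := l x.1.

Definition fibre (S : {set I}) (i : 'I_s) : nat := (\sum_(j < v) ((i, j) \in S))%N.

Lemma lprod_fibre S : lprod line_of S = \prod_i (l i : R) ^+ fibre S i.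
Proof.
rewrite /lprod big_mkcond /=.
rewrite (eq_bigr (fun x : I => (l x.1 : R) ^+ ((x.1, x.2) \in S))); last first.
  by case=> i j _ /=; case: ifP.
rewrite -(pair_bigA _ (fun i j => (l i : R) ^+ ((i, j) \in S))) /=.
by apply: eq_bigr => i _; rewrite prodrXr.
Qed.

Lemma sum_fibre S : (\sum_i fibre S i = #|S|)%N.
Proof.
rewrite pair_bigA /= -sum1_card [RHS]big_mkcond /=.
by apply: eq_bigr => -[i j] _ /=; case: ifP.
Qed.

Lemma fibre_le S i : (fibre S i <= v)%N.
Proof. by rewrite -[leqRHS]card_ord -sum1_card; apply: leq_sum => j _; apply: leq_b1. Qed.

Lemma fibreU1 x S i : x \notin S -> fibre (x |: S) i = ((i == x.1) + fibre S i)%N.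
Proof.
case: x => p q xS; rewrite /fibre.
rewrite (eq_bigr (fun j => ((i, j) == (p, q)) + ((i, j) \in S))%N); last first.
  move=> j _; rewrite in_setU1; have [->|] := eqVneq (i, j) (p, q) => //.
  by rewrite (negbTE xS).
rewrite big_split /=; congr (_ + _)%N.
under eq_bigr do rewrite xpair_eqE.
have [_|_] := eqVneq i p; last by rewrite big1.
by rewrite sum_eq1.
Qed.

(* The complement of [S] lists the degrees of the multigraph [e]. *)
Definition compat (e : 'X_{1..n}) (S : {set I}) : Prop :=
  mdeg e = v /\ forall i, (gdeg e i + fibre S i = v)%N.

Lemma compat_exists S : (#|S| + 2 * v = s * v)%N -> exists e, compat e S.
Proof.
move=> cS; have [i||e [ev ed]] := @multigraph_exists s v (fun i => v - fibre S i)%N.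
- exact: leq_subr.
- rewrite sumnB => [|i _]; last exact: fibre_le.
  by rewrite sum_fibre sum_nat_const card_ord; lia.
by exists e; split=> // i; rewrite ed subnK // fibre_le.
Qed.

(** A canonical set compatible with [e] when [mdeg e = v]: over the line [i] it omits the first
    [gdeg e i] copies. *)
Definition subset_of (e : 'X_{1..n}) : {set I} := [set x : I | (gdeg e x.1 <= x.2)%N].

Lemma compat_subset e : mdeg e = v -> compat e (subset_of e).
Proof.
move=> ev; split=> // i; have := gdeg_le e i; rewrite ev /fibre.
under eq_bigr do rewrite inE /=.
move: (gdeg e i) => d dv.
have -> : (\sum_(j < v) (d <= j) = \sum_(0 <= j < v) (d <= j))%N by rewrite big_mkord.
rewrite (big_cat_nat (n := d)) //= big_nat big1 => [|j]; last by lia.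
rewrite add0n big_nat (eq_bigr (fun=> 1%N)) => [|j /andP[->] //].
by rewrite -big_nat sum_nat_const_nat muln1 subnKC.
Qed.

Lemma compat_card e S : compat e S -> (#|S| + 2 * v = s * v)%N.
Proof.
move=> [ev eS]; rewrite -[X in (2 * X)%N]ev -sum_gdeg -sum_fibre addnC -big_split /=.
by rewrite (eq_bigr _ (fun i _ => eS i)) sum_nat_const card_ord.
Qed.

Lemma compat_prod e S : compat e S -> \prod_k fgens l k ^+ e k = lprod line_of S.
Proof.
move=> [ev eS]; rewrite prod_fgens lprod_fibre; apply: eq_bigr => i _.
by rewrite ev -(eS i) addKn.
Qed.

Lemma rees_compat e S : compat e S ->
  rees_map (fgens l) 'X_[e] = (lprod line_of S)%:P * 'X^v.
Proof. by move=> eS; rewrite rees_mapX (compat_prod eS) eS.1. Qed.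

(** Equal fibres give equal images in the Rees algebra, and the difference of two monomials has
    constant coefficients, hence bidegree [(0, v)]. *)
Lemma compat_eq e e' S S' : compat e S -> compat e' S' -> fibre S =1 fibre S' ->
  fiber_ideal (fgens l) ('X_[e] - 'X_[e']).
Proof.
move=> eS eS' SS'; apply/fiber_ideal_fib/ideal_gen_in; split.
  rewrite /rees_ideal rmorphB /= (rees_compat eS) (rees_compat eS').
  rewrite !lprod_fibre; under eq_bigr do rewrite SS'.
  exact: subrr.
exists v; split; first by rewrite rpredB // dhomogX /= ?eS.1 ?eS'.1.
move=> h; rewrite mcoeffB !mcoeffX.
by rewrite rpredB //; case: eqP => _; rewrite ?dhomog0 ?dhomog1.
Qed.

(** Two copies of one line are covered by [compat_eq]; for distinct lines [third_vertex] leads to a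
    linear syzygy. *)
Lemma koszul_fiber e e' S x y :
  x \notin S -> y \notin S -> compat e (x |: S) -> compat e' (y |: S) ->
  fiber_ideal (fgens l) ((line_of x : R) *: 'X_[e'] - (line_of y : R) *: 'X_[e]).
Proof.
move=> xS yS ex ey.
have [xy|xy] := eqVneq x.1 y.1.
  rewrite /line_of xy -scalerBr -mul_mpolyC; apply: fiber_idealM.
  by apply: compat_eq ey ex _ => i; rewrite !fibreU1 // xy.
(* The degrees [d] left free by [S] sum to [2 * v + 1]; [e] uses all but one unit at [x.1], and [e']
   all but one at [y.1]. *)
pose d i := (v - fibre S i)%N.
have dE i : (d i + fibre S i = v)%N by rewrite subnK ?fibre_le.
have [r [rx ry [h [hv hd]]]] : exists r, [/\ r != x.1, r != y.1 & exists e : 'X_{1..n},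
   (mdeg e).+1 = v /\ forall i,
   d i = (gdeg e i + ((i == x.1) + (i == y.1) + (i == r)))%N].
  apply: third_vertex => //.
  - by move=> i; apply: leq_subr.
  - by have := ex.2 x.1; rewrite fibreU1 // eqxx; have := dE x.1; lia.
  - by have := ey.2 y.1; rewrite fibreU1 // eqxx; have := dE y.1; lia.
  have sd : (\sum_i d i + \sum_i fibre S i = s * v)%N.
    by rewrite -big_split /= (eq_bigr _ (fun i _ => dE i)) sum_nat_const card_ord.
  have := compat_card ex; rewrite cardsU1 xS -sum_fibre.
  by move: sd; rewrite !sum_fibre; lia.
have or_add (p q i : 'I_s) : p != q -> ((i == p) || (i == q) = (i == p) + (i == q) :> nat)%N.
  by move=> pq; have [->|//] := eqVneq i p; rewrite (negbTE pq).
have [kx kxE] := edge_exists rx; have [ky kyE] := edge_exists ry.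
have cx : compat (h + U_(kx))%MM (y |: S).
  split=> [|i]; first by rewrite mdegD mdeg1 addn1.
  rewrite gdegD gdegU kxE or_add // fibreU1 //.
  by have := hd i; have := dE i; lia.
have cy : compat (h + U_(ky))%MM (x |: S).
  split=> [|i]; first by rewrite mdegD mdeg1 addn1.
  rewrite gdegD gdegU kyE or_add // fibreU1 //.
  by have := hd i; have := dE i; lia.
(* Up to relations of bidegree [(0, v)], [e'] and [e] are exchanged for multigraphs sharing [h], and
   a multiple of one linear syzygy remains. *)
have -> : (line_of x : R) *: 'X_[e'] - (line_of y : R) *: 'X_[e] =
  (line_of x : R) *: ('X_[e'] - 'X_[h + U_(kx)]) -
  (line_of y : R) *: ('X_[e] - 'X_[h + U_(ky)]) +
  'X_[h] * ((line_of x : R) *: 'X_kx - (line_of y : R) *: 'X_ky) :> T.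
  have swap (V : zmodType) (a b c f : V) : a - b = (a - c) - (b - f) + (c - f).
    by rewrite opprB -addrA [f - b]addrC (addrACA (- b)) subrr addr0 addrACA addNr addr0.
  rewrite !mpolyXD mulrBr -!scalerAr !scalerBr; exact: swap.
have sN := submodule_fiber_ideal (fgens l).
apply: (submodD sN).
  apply: (submodD sN); last apply: (submodN sN); apply: (submodZ sN).
    exact: compat_eq ey cx _.
  exact: compat_eq ex cy _.
apply/fiber_idealM/fiber_ideal_lin/ideal_gen_in; split.
  (* Multiplying the generator of the edge from [r] to [z] by [l z] restores all forms but [l r],
     whichever [z] is. *)
  have fgens_l z k : r != z -> (forall i, incident k i = (i == r) || (i == z)) ->
      (l z : R) * fgens l k = \prod_(i | i != r) (l i : R).
    move=> rz kE; rewrite [RHS](bigD1 z) 1?eq_sym //= fgensE; congr (_ * _).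
    by apply: eq_bigl => i; rewrite kE negb_or.
  rewrite /rees_ideal rmorphB /= !rees_mapZ !rees_mapX !mulrA -!rmorphM /=.
  have prodU k : \prod_j fgens l j ^+ (U_(k)%MM : 'X_{1..n}) j = fgens l k.
    rewrite (bigD1 k) //= mnm1E eqxx big1 ?mulr1 // => j jk.
    by rewrite mnm1E eq_sym (negbTE jk).
  by rewrite !prodU !fgens_l // !mdeg1 subrr.
exists 1%N; split.
  by rewrite rpredB // dhomogZ // dhomogX /= mdeg1.
move=> g; rewrite mcoeffB !mcoeffZ !mcoeffX.
by rewrite rpredB //; case: eqP => _; rewrite ?mulr1 ?mulr0 ?dhomog0 ?dhomog_is_dhomog.
Qed.


(** No form is set to 0 yet, so [W] is the zero space. A linear relation among the forms yields a
    relation of bidegree [(0, v)], and the Koszul relations are [koszul_fiber]. *)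
Lemma respects_fiber a (tau : {set I} -> 'X_{1..n}) : (a + 2 * v = s * v)%N ->
  (forall S, #|S| = a -> compat (tau S) S) ->
  respects line_of [set: I] a 0%VS (fiber_ideal (fgens l)) (fun S => 'X_[tau S] : T).
Proof.
move=> av tauP; split=> [S c _ Sa cS|S x y _ Sa|S w _ _].
- have tauS x : x \in [set: I] :\: S -> compat (tau (x |: S)) (x |: S).
    by rewrite !inE andbT => xS; apply: tauP; rewrite cardsU1 xS add1n.
  apply/fiber_ideal_fib/ideal_gen_in; split.
    rewrite /rees_ideal raddf_sum /=.
    have -> : \sum_(i in [set: I] :\: S)
          rees_map (fgens l) ((c i)%:MP *: 'X_[tau (i |: S)]) =
        (((\sum_(i in [set: I] :\: S) c i *: line_of i : dhomog 3 K 1) : R) *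
          lprod line_of S)%:P * 'X^v.
      rewrite linear_sum /= mulr_suml rmorph_sum mulr_suml; apply: eq_bigr => i iS.
      rewrite rees_mapZ (rees_compat (tauS i iS)) mulrA -rmorphM /=.
      rewrite lprodU1; last by move: iS; rewrite !inE andbT.
      by rewrite mul_mpolyC -scalerAl.
    by move: cS; rewrite memv0 => /eqP->; rewrite /= mul0r rmorph0 mul0r.
  exists v; split.
    by apply: rpred_sum => i /tauS[iv _]; rewrite rpredZ // dhomogX /= iv.
  move=> h; rewrite linear_sum /=; apply: rpred_sum => i _.
  rewrite mcoeffZ mcoeffX -[(c i)%:MP]mulr1 -mulrA mul_mpolyC mul1r rpredZ //.
  by case: eqP => _; rewrite ?dhomog0 ?dhomog1.
- rewrite !inE !andbT => xS yS.
  by apply: koszul_fiber (xS) (yS) _ _; apply: tauP; rewrite cardsU1 ?xS ?yS add1n.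
rewrite memv0 => /eqP->; rewrite scale0r; exact: submod0 (submodule_fiber_ideal _).
Qed.

Lemma fiber_homog (F : T) : (1 < s)%N ->
  \sum_(e <- msupp F | mdeg e == v) F@_e * \prod_k fgens l k ^+ e k = 0 ->
  fiber_ideal (fgens l) (pihomog mdeg v F).
Proof.
(* This is [(s - 2) * v]; the bound on [s] keeps the truncated subtraction exact. *)
move=> s_gt1 F0; pose a := (s * v - 2 * v)%N.
have av : (a + 2 * v = s * v)%N by rewrite subnK // leq_mul2r s_gt1 orbT.
have [tau tauP] : exists tau : {set I} -> 'X_{1..n}, forall S, #|S| = a -> compat (tau S) S.
  apply: (@fin_all_exists _ (fun=> 'X_{1..n}) (fun S e => #|S| = a -> compat e S)) => S.
  have [Sa|Sa] := eqVneq #|S| a; last by exists 0%MM => /eqP; rewrite (negbTE Sa).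
  by have [e eS] := compat_exists (etrans (congr1 (addn^~ _) Sa) av); exists e.
have sN := submodule_fiber_ideal (fgens l).
have card_subset e : mdeg e = v -> #|subset_of e| = a.
  by move/compat_subset/compat_card; rewrite -av => /addIn.
rewrite pihomogE.
(* Each monomial is exchanged for the chosen one with the same degrees, at the cost of relations of
   bidegree [(0, v)]. *)
have -> : \sum_(e <- msupp F | mdeg e == v) F@_e *: 'X_[e] =
    \sum_(e <- msupp F | mdeg e == v) F@_e *: ('X_[e] - 'X_[tau (subset_of e)]) +
    \sum_(e <- msupp F | mdeg e == v) F@_e *: 'X_[tau (subset_of e)] :> T.
  by rewrite -big_split /=; apply: eq_bigr => e _; rewrite -scalerDr subrK.
apply: (submodD sN).
  apply: (submod_sum _ sN) => e /eqP ev; apply: (submodZ sN).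
  have eS := compat_subset ev.
  exact: compat_eq eS (tauP _ (card_subset _ ev)) _.
(* Collecting coefficients by subset turns the relation into a syzygy of [a]-fold products. *)
pose g S := \sum_(e <- msupp F | (mdeg e == v) && (subset_of e == S)) F@_e.
have part (V : lmodType R) (G : {set I} -> V) :
    \sum_(e <- msupp F | mdeg e == v) F@_e *: G (subset_of e) =
    \sum_(S : {set I} | (S \subset [set: I]) && (#|S| == a)) g S *: G S.
  rewrite (partition_big (@subset_of) (fun S => (S \subset [set: I]) && (#|S| == a))) /=.
    by apply: eq_bigr => S _; rewrite scaler_suml; apply: eq_bigr => e /andP[_ /eqP->].
  by move=> e /eqP /card_subset->; rewrite subsetT eqxx.
rewrite (part _ (fun S => 'X_[tau S])).
apply: (syzygy_gen sN (respects_fiber av tauP)).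
rewrite -(part R^o (lprod line_of)) (_ : \sum_(_ <- _ | _) _ = 0); first exact: ideal_gen0.
rewrite -[RHS]F0; apply: eq_bigr => e /eqP ev.
by rewrite (compat_prod (compat_subset ev)).
Qed.

End Lines.

(** The Rees ideal is graded by the degree in the [t]: the coefficient of ['X^v] in the image of [F]
    involves only the component of degree [v]. *)
Lemma fiber_type_fgens (K : fieldType) (s : nat) (l : 'I_s -> dhomog 3 K 1) :
  (1 < s)%N -> fiber_type (fgens l).
Proof.
move=> s_gt1 F; split=> [rF|]; last exact: fiber_ideal_rees.
rewrite (pihomog_partitionE (leqnn (mmeasure mdeg F))).
apply: (submod_sum _ (submodule_fiber_ideal (fgens l))) => v _.
by apply: fiber_homog => //; rewrite -coef_rees_map rF coef0.
Qed.

Theorem theorem3p5 (K : fieldType) (charK : [pchar K] =i pred0)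
    (s : nat) (l : 'I_s -> dhomog 3 K 1)
    (rank3 : \dim <<[seq l i | i : 'I_s]>>%VS = 3%N)
    (coprime_l : forall i j : 'I_s, i != j ->
       gcd1 (l i : {mpoly K[3]}) (l j : {mpoly K[3]})) :
  fiber_type (fgens l).
Proof.
(* A span of dimension 3 needs at least three forms, so [s] is at least 3. *)
apply: fiber_type_fgens; apply: (@leq_trans 3) => //.
by rewrite -rank3 (leq_trans (dim_span _)) // size_image card_ord.
Qed.
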